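(* Let $g\ge 0$, $n\ge 1$ be integers with $2g-2+n>0$. Then $$N_{g,n}(b_1,\dots,b_n)=V_{g,n}(b_1,\dots,b_n)+\text{lower order terms}.$$ That is, for each parity class of $(b_1,\dots,b_n)$ with $\sum_i b_i$ even, the polynomial in $b_1,\dots,b_n$ representing $N_{g,n}$ on that class has homogeneous top degree part (of degree $6g-6+2n$ in the $b_i$) equal to the volume polynomial $V_{g,n}(b_1,\dots,b_n)$.
   Context: A fatgraph $\Gamma$ is a finite connected graph (loops and multiple edges allowed) with all vertices of valency $>2$, equipped with a cyclic ordering of the (half-)edges at each vertex. Equivalently: let $X$ be the set of oriented edges of $\Gamma$ (each edge appears twice), $\tau_1:X\to X$ the involution reversing orientation, and $\tau_0:X\to X$ the map cyclically permuting the oriented edges with a common source vertex. Then the vertices are $X_0=X/\tau_0$, the edges are $X_1=X/\tau_1$, and the boundary components are $X_2=X/\tau_2$ with $\tau_2=\tau_0\tau_1$. The genus $g$ of a fatgraph with $n=|X_2|$ boundary components is defined by $|X_0|-|X_1|+|X_2|=2-2g$. A labeled fatgraph is a fatgraph whose boundary components are labeled $1,\dots,n$. $\mathcal{F}at_{g,n}$ denotes the (finite) set of isomorphism classes of labeled fatgraphs of genus $g$ with $n$ boundary components. An automorphism of a labeled fatgraph is a permutation of $X$ commuting with $\tau_0$ and $\tau_1$ and acting trivially on $X_2$; $Aut\,\Gamma$ is the group of these. Let $e(\Gamma)=|X_1|$ and let $A_\Gamma$ be the $n\times e(\Gamma)$ incidence matrix that sends each edge to the sum of its two incident boundary components (if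 both sides of an edge lie on the same boundary component $i$, the corresponding column has the entry $2$ in row $i$). For $\mathbf{b}=(b_1,\dots,b_n)\in\mathbb{R}_{>0}^n$ let $P_\Gamma(\mathbf{b})=\{\mathbf{x}\in\mathbb{R}_{>0}^{e(\Gamma)} : A_\Gamma\mathbf{x}=\mathbf{b}\}$. For positive integers $b_1,\dots,b_n$ let $$N_\Gamma(b_1,\dots,b_n)=\#\left(P_\Gamma(\mathbf{b})\cap\mathbb{Z}^{e(\Gamma)}\right),\qquad N_{g,n}(b_1,\dots,b_n)=\sum_{\Gamma\in\mathcal{F}at_{g,n}}\frac{1}{|Aut\,\Gamma|}N_\Gamma(b_1,\dots,b_n).$$ On each parity class of $(b_1,\dots,b_n)$ (fixing each $b_i$ modulo 2), $N_{g,n}$ agrees with a polynomial in $b_1^2,\dots,b_n^2$; it vanishes identically when $\sum_i b_i$ is odd. The volume polynomial (Kontsevich) is $$V_{g,n}(b_1,\dots,b_n)=\sum_{\Gamma\in\mathcal{F}at_{g,n}}\frac{1}{|Aut\,\Gamma|}Vol_\Gamma(b_1,\dots,b_n),$$ where $Vol_\Gamma(\mathbf{b})$ is the $(6g-6+2n)$-dimensional volume of the convex polytope $P_\Gamma(\mathbf{b})$ (zero if $P_\Gamma(\mathbf{b})$ is empty or of smaller dimension), measured with the translation-invariant measure on the affine space $\{A_\Gamma\mathbf{x}=\mathbf{b}\}$ for which a fundamental domain of the lattice $\ker A_\Gamma\cap\mathbb{Z}^{e(\Gamma)}$ has volume $1$ (a point has volume $1$ in dimension $0$). Off a finite union of hyperplanes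 in $\mathbb{R}^n_{>0}$ this sum is given by a single homogeneous polynomial in $b_1,\dots,b_n$ (Kontsevich), and $V_{g,n}$ denotes that polynomial. *)

(* Defs.v *)
From mathcomp Require Import all_boot all_order all_algebra all_fingroup.
From mathcomp Require Import finmap zify.
From mathcomp Require Import all_classical all_reals all_analysis.
(* The notations of mpoly clash with those of analysis. *)
From mathcomp Require Import -(notations) mpoly.

Set Implicit Arguments.
Unset Strict Implicit.
Unset Printing Implicit Defensive.

Import Order.TTheory GRing.Theory Num.Theory.

Local Open Scope ring_scope.

(* (tau0, tau1, label): the oriented edges are the points of X, and [label x]
   is the label of the boundary component containing x. *)
Definition fatdata (X : finType) (n : nat) : Type :=
  ({perm X} * {perm X} * {ffun X -> 'I_n})%type.

Definition tau0 (X : finType) n (G : fatdata X n) : {perm X} := G.1.1.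
Definition tau1 (X : finType) n (G : fatdata X n) : {perm X} := G.1.2.
Definition label (X : finType) n (G : fatdata X n) : {ffun X -> 'I_n} := G.2.

(* The composite x |-> tau0 (tau1 x): products in {perm X} apply the left
   factor first. *)
Definition tau2 (X : finType) n (G : fatdata X n) : {perm X} :=
  (tau1 G * tau0 G)%g.

Definition vertices (X : finType) n (G : fatdata X n) : {set {set X}} :=
  porbits (tau0 G).
Definition edges (X : finType) n (G : fatdata X n) : {set {set X}} :=
  porbits (tau1 G).
Definition boundaries (X : finType) n (G : fatdata X n) : {set {set X}} :=
  porbits (tau2 G).

(* The label conditions say that [label] induces a bijection from the set of
   boundary components to 'I_n; the Euler characteristic equation is written
   without subtraction. *)
Definition is_fatgraph (g : nat) (X : finType) n (G : fatdata X n) : bool :=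
  [&& [forall x, (tau1 G x != x) && (tau1 G (tau1 G x) == x)],
      [forall v in vertices G, (2 < #|v|)%N],
      [forall x, forall y,
         connect (fun u v => (v == tau0 G u) || (v == tau1 G u)) x y],
      [forall x, forall y,
         (label G x == label G y) == (y \in porbit (tau2 G) x)],
      [forall i, exists x, label G x == i] &
      (#|vertices G| + #|boundaries G| + 2 * g == #|edges G| + 2)%N].

Definition fat_iso (X : finType) n (G H : fatdata X n) : bool :=
  [exists s : {perm X}, forall x,
     [&& s (tau0 G x) == tau0 H (s x), s (tau1 G x) == tau1 H (s x) &
         label H (s x) == label G x]].

Definition fat_aut (X : finType) n (G : fatdata X n) : {set {perm X}} :=
  [set s : {perm X} | [forall x,
     [&& s (tau0 G x) == tau0 G (s x), s (tau1 G x) == tau1 G (s x) &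
         porbit (tau2 G) (s x) == porbit (tau2 G) x]]].

(* One representative of each isomorphism class of labeled fatgraphs of genus
   g with n boundary components and k oriented edges. *)
Definition Fat (g n k : nat) : {set fatdata 'I_k n} :=
  let D := [set G : fatdata 'I_k n | is_fatgraph g G] in
  transversal (equivalence_partition (@fat_iso 'I_k n) D) D.

Lemma porbits_partition (X : finType) (s : {perm X}) :
  finset.partition (porbits s) [set: X].
Proof.
have acts_s : [acts <[s]>%g, on [set: X]%SET | 'P%act].
  by apply/actsP => a _ x; rewrite !inE.
rewrite /porbits (_ : _ @: _ = orbit 'P%act <[s]>%g @: [set: X]%SET).
  exact: orbit_partition acts_s.
apply/setP => S; apply/imsetP/imsetP => -[x _ ->]; exists x => //;
  by rewrite porbit.unlock.
Qed.

Lemma fatgraph_size g (X : finType) n (G : fatdata X n) :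
  is_fatgraph g G -> (#|X| <= 12 * g + 6 * n - 12)%N.
Proof.
case/and5P => /forallP h1 /forall_inP h0 _ /forallP h2 /andP[_ /eqP euler].
have le_e : (#|X| <= 2 * #|edges G|)%N.
  rewrite -cardsT (card_partition (porbits_partition (tau1 G))) mulnC.
  rewrite -sum_nat_const; apply: leq_sum => _ /imsetP[x _ ->].
  have [_ /eqP tt] := andP (h1 x).
  apply: (@leq_trans #|[set x; tau1 G x]%SET|); last first.
    by rewrite cards2; case: eqP.
  apply/subset_leq_card/fintype.subsetP => y /porbitP[i ->].
  elim: i => [|i]; first by rewrite expg0 perm1 !inE eqxx.
  rewrite expgSr permM !inE => /orP[] /eqP ->; rewrite ?eqxx ?orbT //.
  by rewrite tt eqxx.
have le_v : (3 * #|vertices G| <= #|X|)%N.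
  rewrite -cardsT (card_partition (porbits_partition (tau0 G))) mulnC.
  by rewrite -sum_nat_const; apply: leq_sum => v /h0.
have le_b : (#|boundaries G| <= n)%N.
  rewrite -[leqRHS]card_ord.
  pose f (S : {set X}) : option 'I_n := omap (label G) [pick x in S].
  have f_porbit x : f (porbit (tau2 G) x) = Some (label G x).
    rewrite /f; case: pickP => [y|/(_ x)]; last by rewrite porbit_id.
    have /forallP/(_ y)/eqP <- := h2 x.
    by move=> /eqP /= ->.
  have f_inj : {in boundaries G &, injective f}.
    move=> _ _ /imsetP[x _ ->] /imsetP[y _ ->].
    rewrite !f_porbit => -[/eqP].
    have /forallP/(_ y)/eqP -> := h2 x.
    by rewrite -eq_porbit_mem eq_sym => /eqP.
  have Some_inj : injective (@Some 'I_n) by move=> ? ? [].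
  rewrite -(card_in_imset f_inj) -(card_imset _ Some_inj).
  apply/subset_leq_card/fintype.subsetP => _ /imsetP[_ /imsetP[x _ ->] ->].
  by rewrite f_porbit; apply: imset_f.
lia.
Qed.

(* A fatgraph has at most 6g-6+3n edges (see [fatgraph_size]), so that the
   range of k covers all isomorphism classes. *)
Definition fat_sum (R : realType) (g n : nat)
    (F : forall k, fatdata 'I_k n -> R) : R :=
  \sum_(k < (12 * g + 6 * n - 12).+1) \sum_(G in Fat g n k)
     (#|fat_aut G|%:R)^-1 * F k G.

(* The entry at (i, j) is the number of sides of the j-th edge that lie on the
   boundary component labeled i. *)
Definition incidence (X : finType) n (G : fatdata X n) :
    'M[int]_(n, #|edges G|) :=
  \matrix_(i, j) #|[set x in (enum_val j : {set X}) | label G x == i]|%:Z.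

Definition polytope (R : realType) n e (A : 'M[int]_(n, e)) (b : 'I_n -> R)
    : set 'cV[R]_e :=
  [set x : 'cV[R]_e | (forall j, 0 < x j 0) /\ map_mx intr A *m x = \col_i b i]%classic.

Definition lattice_points (R : realType) n e (A : 'M[int]_(n, e))
    (b : 'I_n -> R) : set 'cV[int]_e :=
  [set x : 'cV[int]_e | polytope A b (map_mx intr x)]%classic.

Lemma lattice_points_finite (R : realType) (X : finType) n
    (G : fatdata X n) (b : 'I_n -> R) :
  finite_set (lattice_points (incidence G) b).
Proof.
pose B := \sum_i `|b i|.
pose M := `|Num.ceil B|%N.
pose f (t : {ffun 'I_#|edges G| -> 'I_M.+1}) : 'cV[int]_#|edges G| :=
  \col_j (t j)%:Z.
apply: (@sub_finite_set _ _ (f @` setT)); last exact: finite_image.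
move=> x [x_gt0 /matrixP Ax].
have x_le j : x j 0 <= Num.ceil B.
  have : enum_val j \in edges G by exact: enum_valP.
  case/imsetP => u _ ej.
  have uj : u \in (enum_val j : {set X}) by rewrite ej porbit_id.
  have /= := Ax (label G u) 0; rewrite !mxE => bE.
  rewrite -(ler_int R); apply: le_trans (ceil_ge B).
  apply: (@le_trans _ _ (b (label G u))).
    rewrite -bE (bigD1 j) //= !mxE.
    apply: (@le_trans _ _ (#|[set x0 in (enum_val j : {set X}) | label G x0 == label G u]%SET|%:Z%:~R * (x j 0)%:~R)).
      rewrite ler_peMl //; first by have := x_gt0 j; rewrite mxE => /ltW.
      by rewrite ler1n card_gt0; apply/set0Pn; exists u; rewrite inE uj eqxx.
    rewrite lerDl; apply: sumr_ge0 => i _; rewrite !mxE mulr_ge0 //.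
    by have := x_gt0 i; rewrite mxE => /ltW.
  apply: (le_trans (ler_norm _)); rewrite /B (bigD1 (label G u)) //= lerDl.
  by apply: sumr_ge0 => i _.
have xE j : x j ord0 = absz (x j ord0).
  by rewrite gez0_abs //; have := x_gt0 j; rewrite mxE ltr0z => /ltW.
exists [ffun j => inord (absz (x j ord0))] => //.
apply/matrixP => j k; rewrite !mxE ffunE (ord1 k) inordK -?xE // ltnS /M.
by rewrite -lez_nat -xE (le_trans (x_le j)) // abszE ler_norm.
Qed.

Definition lattice_count (R : realType) (g n : nat) (b : 'I_n -> nat) : R :=
  fat_sum g (fun k (G : fatdata 'I_k n) =>
    #|` fset_set (lattice_points (incidence G) (fun i => (b i)%:R : R))|%:R).

(* d-dimensional Lebesgue measure, as the d-fold iterated product of the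
   Lebesgue measure on R: the successor case is the unfolding of [m1 \x m2]. *)
Fixpoint lebesgue_volume (R : realType) (d : nat) :
    set 'cV[R]_d -> \bar R :=
  match d return set 'cV[R]_d -> \bar R with
  | 0 => fun S => (\1_S 0)%:E
  | d'.+1 => fun S => (\int[@lebesgue_measure R]_t
      lebesgue_volume [set v | S (col_mx t%:M v : 'cV[R]_(1 + d'))]%classic)%E
  end.

(* The columns of B form a basis of the lattice of integer points of ker A. *)
Definition kernel_basis n e d (A : 'M[int]_(n, e)) (B : 'M[int]_(e, d)) : Prop :=
  forall y : 'cV[int]_e, A *m y = 0 <-> exists! t : 'cV[int]_d, y = B *m t.

(* z = (B, x0) gives the lattice-preserving parametrization t |-> x0 + B t
   of the affine space {x | A x = b}. *)
Definition affine_frame (R : realType) n e d (A : 'M[int]_(n, e))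
    (b : 'I_n -> R) (z : 'M[int]_(e, d) * 'cV[R]_e) : Prop :=
  kernel_basis A z.1 /\ map_mx intr A *m z.2 = \col_i b i.

(* The d-dimensional volume of the polytope, normalized by the integer lattice
   of ker A. Two frames differ by a translation and an element of GL_d(Z),
   so the value does not depend on the chosen one. There is no frame when the
   affine space is empty or its dimension is not d. *)
Definition polytope_volume (R : realType) n e (d : nat) (A : 'M[int]_(n, e))
    (b : 'I_n -> R) : R :=
  if pselect (exists z : 'M[int]_(e, d) * 'cV[R]_e, affine_frame A b z)
    is left h then
    let z := projT1 (cid h) in
    fine (lebesgue_volume
      [set t : 'cV[R]_d | polytope A b (z.2 + map_mx intr z.1 *m t)]%classic)
  else 0.

(* The subtraction does not truncate when 2g - 2 + n > 0. *)
Definition moduli_dim (g n : nat) : nat := (6 * g + 2 * n - 6)%N.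

Definition volume_sum (R : realType) (g n : nat) (b : 'I_n -> R) : R :=
  fat_sum g (fun k (G : fatdata 'I_k n) =>
    polytope_volume (moduli_dim g n) (incidence G) b).

(* V is the homogeneous polynomial that gives the sum of the volumes off the
   hyperplanes {b | sum_i a_i b_i = c} with (a, c) in H. *)
Definition is_volume_polynomial (R : realType) (g n : nat)
    (V : mpoly n R) : Prop :=
  V \is ishomog (@mdeg n) /\
  exists2 H : seq ('rV[R]_n * R), {in H, forall h : 'rV[R]_n * R, h.1 != 0} &
    forall b : 'I_n -> R, (forall i, 0 < b i) ->
      {in H, forall h : 'rV[R]_n * R, \sum_i h.1 0 i * b i != h.2} ->
      meval b V = volume_sum g b.

(* p represents the lattice point count on the class of the positive b with
   b i odd exactly when eps i. *)
Definition is_count_polynomial (R : realType) (g n : nat) (eps : 'I_n -> bool)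
    (p : mpoly n R) : Prop :=
  forall b : 'I_n -> nat, (forall i, (0 < b i)%N) ->
    (forall i, odd (b i) = eps i) ->
    meval (fun i => (b i)%:R) p = lattice_count R g b.

(* Main.v *)
Require Import Defs.
From mathcomp Require Import all_boot all_order all_algebra all_fingroup.
From mathcomp Require Import finmap zify ring lra.
From mathcomp Require Import all_classical all_reals all_analysis.
From mathcomp Require Import measurable_realfun.
From mathcomp Require Import -(notations) mpoly.

Set Implicit Arguments.
Unset Strict Implicit.
Unset Printing Implicit Defensive.

Import Order.TTheory GRing.Theory Num.Theory.
Import numFieldNormedType.Exports.

Local Open Scope classical_set_scope.
Local Open Scope ring_scope.

Local Notation wid := (widen_ord (leqnSn _)).
Local Notation real_mx R A := (map_mx (intr : int -> R) A).

(** Fix a point [b] of the parity class, in general position, and dilate it by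
    odd factors [m]: the points [m b] stay in the class. Write
    [D = 6 g - 6 + 2 n]. The value [p (m b)] is a polynomial in [m], and it is
    the weighted sum over the fatgraphs of the numbers of integer points in the
    dilated polytopes [m P(b)]. Divided by [m ^ D], each of these numbers tends
    to the volume of [P(b)] ([cvg_lattice]), hence [p (m b) / m ^ D] tends to
    [V b]. A polynomial in [m] with this growth has degree at most [D] and
    coefficient [V b] at [m ^ D] ([size_lim_horner]); that is, the homogeneous
    parts of [p] of degree above [D] vanish at [b] and the one of degree [D]
    takes the value [V b]. As such points [b] are Zariski dense
    ([mpoly_grid_eq0]), these equalities hold between polynomials
    ([mpoly_top_part]).

    For one fatgraph with [e] edges and incidence matrix [A], the Euler
    characteristic and the bound on the valencies give [e <= n + D]
    ([edges_le]), and three cases arise. If the rows of [A] are dependent, say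
    [c A = 0], then [A x = m b] forces [c b = 0]: for general [b] there is
    neither an integer point nor a volume. If the rows are independent and
    [e < n + D], the integer points lie on a lattice of rank [e - n < D], so
    their number is [o(m ^ D)] ([cvg_lattice_low]), and the [D]-dimensional
    volume is zero. If [e = n + D], some vertex is trivalent; the three
    boundary components around it make the dual graph non-bipartite, and then
    the integer combinations of the columns of [A] are all the vectors of even
    sum ([incidence_even]). This is where the parity of [b] enters: [A x = b]
    has an integer solution, [P(b)] is a polytope in an affine lattice, and its
    dilates contain asymptotically [m ^ D] times its volume of lattice points
    ([cvg_lattice_top]).

    The last fact is [cvg_density]. It follows the definition of the volume as
    an iterated integral, by induction on the dimension: the number of lattice
    points of a dilate is the integral of a step function whose value at [t] is
    the number of lattice points in the slice at height [floor (m t) / m], and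
    dominated convergence passes to the limit. That slice moves with [m], so the
    statement proved by induction lets the walls of the polytope depend on [m]
    and converge. *)

(** * Polynomials determined by their growth on a grid *)

Lemma muni_eq0 (R : comNzRingType) n (p : mpoly n.+1 R) :
  muni p = 0 -> p = 0.
Proof.
move=> p0; apply/mpolyP => m; rewrite mcoeff0.
have <- : mcoeff (Multinom [tuple m (wid i) | i < n]) (muni p)`_(m ord_max)
    = mcoeff m p.
  rewrite muniE coef_sum (raddf_sum (mcoeff _)) [in RHS](mpolyE p).
  rewrite (raddf_sum (mcoeff _)).
  apply: eq_bigr => m' _; rewrite coefZ coefXn mulr_natr raddfMn /= mcoeffZ.
  rewrite mcoeffZ !mcoeffX -[LHS]mulr_natr -mulrA; congr (_ * _).
  rewrite -natrM mulnb; congr (_%:R); congr nat_of_bool.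
  apply/andP/eqP => [[/eqP/mnmP e1 /eqP e2]|->]; last by rewrite !eqxx.
  apply/mnmP => i; case: (unliftP ord_max i) => [j|] -> //.
  suff -> : lift ord_max j = wid j by have := e1 j; rewrite !mnmE.
  by apply/val_inj; rewrite /= /bump leqNgt ltn_ord.
by rewrite p0 coef0 mcoeff0.
Qed.

Lemma meval_muni (R : comNzRingType) n (p : mpoly n.+1 R) (v : 'I_n.+1 -> R) :
  meval v p = (map_poly (meval (v \o wid)) (muni p)).[v ord_max].
Proof.
rewrite mevalE muniE (raddf_sum (map_poly (meval (v \o wid)))) horner_sum.
apply: eq_bigr => m _; rewrite /= map_polyZ map_polyXn hornerZ hornerXn /=.
rewrite mevalZ mevalX -mulrA; congr (_ * _).
rewrite big_ord_recr /=; congr (_ * _).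
by apply: eq_bigr => i _; rewrite !mnmE.
Qed.

(** Seen as a polynomial in the last variable, [p] has infinitely many roots as
    soon as the other variables are specialized to a point of the grid, so its
    coefficients vanish on a grid in one dimension less. *)
Lemma mpoly_grid_eq0 (R : idomainType) n (a : 'I_n -> nat -> R)
    (p : mpoly n R) :
  (forall i, injective (a i)) ->
  (forall k : 'I_n -> nat, meval (fun i => a i (k i)) p = 0) -> p = 0.
Proof.
elim: n a p => [|n IHn] a p a_inj p0.
  have := p0 (fun=> 0%N).
  by rewrite [p]nvar0_mpolyC mevalC => ->; rewrite mpolyC0.
apply: muni_eq0; apply/polyP => j; rewrite coef0.
apply: (IHn (fun i => a (wid i))) => [i|k]; first exact: a_inj.
set v := fun i => _.
suff q0 : map_poly (meval v) (muni p) = 0.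
  by rewrite -(coef_map (meval v)) q0 coef0.
pose N := size (map_poly (meval v) (muni p)).
apply: (@roots_geq_poly_eq0 _ _ [seq a ord_max l | l <- iota 0 N]).
- apply/allP => _ /mapP[l _ ->]; rewrite rootE.
  pose k' i := if unlift ord_max i is Some j then k j else l.
  have := p0 k'; rewrite meval_muni /k' unlift_none => <-.
  apply/eqP; congr (_.[_]); apply: eq_map_poly => q; apply: meval_eq => i.
  rewrite /v /=; congr (a _ _).
  suff -> : wid i = lift ord_max i by rewrite liftK.
  by apply/val_inj; rewrite /= /bump leqNgt ltn_ord.
- by rewrite map_inj_uniq ?iota_uniq //; exact: a_inj.
- by rewrite size_map size_iota.
Qed.

Lemma meval_scale (R : comNzRingType) n (p : mpoly n R) (b : 'I_n -> R)
    (t : R) N :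
  (msize p <= N)%N ->
  meval (fun i => t * b i) p =
    (\poly_(d < N) meval b (pihomog (@mdeg n) d p)).[t].
Proof.
move=> pN; rewrite {1}(pihomog_partitionE (mf := @mdeg n) pN) raddf_sum /=.
rewrite horner_poly; apply: eq_bigr => d _.
rewrite pihomogE !raddf_sum /= mulr_suml; apply: eq_bigr => m /eqP <-.
rewrite !mevalZ !mevalX -mulrA; congr (_ * _).
rewrite (eq_bigr (fun i => t ^+ m i * b i ^+ m i)); last first.
  by move=> i _; rewrite exprMn.
by rewrite big_split /= prodrXr mulrC mdegE.
Qed.

Lemma cvg_even (T : topologicalType) (u : nat -> T) (l : T) :
  u @ \oo --> l -> u (2 * m)%N @[m --> \oo] --> l.
Proof.
move=> ul; apply: (cvg_comp (fun m => 2 * m)%N u) ul => A [N _ NA].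
by exists N => // m /= Nm; apply: NA => /=; rewrite (leq_trans Nm)// leq_pmull.
Qed.

(** [q x / x ^ D] is the value at [1 / x] of the reciprocal polynomial of [q],
    whose constant coefficient is [q`_D]. *)
Lemma cvg_horner_div (R : realType) (q : {poly R}) D :
  (size q <= D.+1)%N ->
  q.[m.+1%:R] / m.+1%:R ^+ D @[m --> \oo] --> q`_D.
Proof.
move=> qD; pose r := \poly_(i < D.+1) q`_(D - i).
have -> : (fun m : nat => q.[m.+1%:R] / m.+1%:R ^+ D) =
    (fun m : nat => r.[harmonic m]).
  apply/funext => m; rewrite (horner_coef_wide _ qD) mulr_suml horner_poly.
  rewrite (reindex_inj rev_ord_inj) /=.
  apply: eq_bigr => i _; rewrite subSS -mulrA; congr (_ * _).
  rewrite /harmonic exprVn -[X in _ / _ ^+ X](subnK (leq_ord i)) exprD invfM.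
  by rewrite mulrA divff ?mul1r// expf_neq0// pnatr_eq0.
have -> : q`_D = r.[0] by rewrite horner_coef0 coef_poly /= subn0.
apply: (cvg_comp _ (horner r)); last exact: continuous_horner.
exact: cvg_harmonic.
Qed.

(** If the degree [s] of [q] exceeded [D], then [q x / x ^ s] would tend to [0]
    as well as to the leading coefficient of [q]. *)
Lemma size_lim_horner (R : realType) (q : {poly R}) D (l : R) :
  q.[(2 * m).+1%:R] / (2 * m).+1%:R ^+ D @[m --> \oo] --> l ->
  (size q <= D.+1)%N /\ q`_D = l.
Proof.
move=> ql; suff qD : (size q <= D.+1)%N.
  split=> //; have := cvg_even (cvg_horner_div qD); move/cvg_unique; apply=> //.
rewrite leqNgt; apply/negP => qD.
have q0 : q != 0 by rewrite -size_poly_gt0 (leq_ltn_trans _ qD).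
have := cvg_even (@cvg_horner_div R q (size q).-1 (leqSpred _)).
rewrite -lead_coefE => qlc; move: (q0); rewrite -lead_coef_eq0 => /eqP; apply.
apply: (cvg_unique _ qlc) => //.
rewrite -(mulr0 l).
have -> : (fun m : nat => q.[(2 * m).+1%:R] / (2 * m).+1%:R ^+ (size q).-1) =
    (fun m : nat => (q.[(2 * m).+1%:R] / (2 * m).+1%:R ^+ D) *
      (harmonic (2 * m)%N) ^+ ((size q).-1 - D)).
  apply/funext => m; rewrite -mulrA; congr (_ * _).
  have lDs : (D <= (size q).-1)%N by case: (size q) qD => // k /ltnW.
  by rewrite /harmonic exprVn -invfM -exprD subnKC.
apply: cvgM ql _.
have -> : 0 = ('X^((size q).-1 - D)).[0] :> R.
  rewrite hornerXn expr0n subn_eq0; case: leqP => // sD.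
  case: (size q) qD sD => // k; rewrite ltnS => Dk /(leq_trans Dk).
  by rewrite ltnn.
under eq_cvg do rewrite -hornerXn.
apply: (cvg_comp _ (horner _)); last exact: continuous_horner.
by apply: cvg_even; exact: cvg_harmonic.
Qed.

(** Genericity in the Zariski topology. *)
Definition generic (R : realType) n (P : ('I_n -> R) -> Prop) : Prop :=
  exists2 w : mpoly n R, w != 0 & forall b, meval b w != 0 -> P b.

(** A nonzero linear form plus a constant is not the zero polynomial: evaluate
    it at the origin and at the coordinate vectors. *)
Lemma generic_affine (R : realType) n (c : 'rV[R]_n) (s : R) :
  c != 0 -> generic (fun b => \sum_i c 0 i * b i != s).
Proof.
move=> c0; pose w : mpoly n R := \sum_i c 0 i *: mpolyX R (mnm1 i) - mpolyC n s.
have wE b : meval b w = \sum_i c 0 i * b i - s.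
  rewrite mevalB mevalC (raddf_sum (meval b)); congr (_ - _).
  by apply: eq_bigr => i _; rewrite /= mevalZ mevalXU.
exists w => [|b]; last by rewrite wE subr_eq0.
apply: contra_neq c0 => w0.
have s0 : s = 0.
  have := wE (fun=> 0); rewrite w0 meval0 big1 => [|i _]; last exact: mulr0.
  by rewrite add0r => /esym/eqP; rewrite oppr_eq0 => /eqP.
apply/matrixP => i j; rewrite !ord1 mxE.
have := wE (fun k => (k == j)%:R).
rewrite w0 meval0 s0 subr0 (bigD1 j)//= eqxx mulr1.
by rewrite big1 ?addr0// => k /negPf->; exact: mulr0.
Qed.

Lemma genericT (R : realType) n (P : ('I_n -> R) -> Prop) :
  (forall b, P b) -> generic P.
Proof. by move=> ?; exists 1; rewrite ?oner_eq0. Qed.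

Lemma generic_forall (R : realType) n (T : finType)
    (P : T -> ('I_n -> R) -> Prop) :
  (forall t, generic (P t)) -> generic (fun b => forall t, P t b).
Proof.
move=> /(_ _)/cid2-/all_sig2[w w0 wP].
exists (\prod_t w t) => [|b]; first by apply/prodf_neq0 => t _; exact: w0.
rewrite (rmorph_prod (meval b)) => /prodf_neq0 bw t; exact/wP/bw.
Qed.

Lemma generic_and (R : realType) n (P Q : ('I_n -> R) -> Prop) :
  generic P -> generic Q -> generic (fun b => P b /\ Q b).
Proof.
move=> [v v0 vP] [w w0 wQ]; exists (v * w) => [|b]; first by rewrite mulf_neq0.
by rewrite mevalM mulf_eq0 negb_or => /andP[/vP ? /wQ].
Qed.

(** The grid spanned by the values of [a] makes the generic points of [S]
    Zariski dense, so it is enough to find the homogeneous parts of [p] at such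
    points [b]. There they are the coefficients of the polynomial [p (t b)]
    in [t], which the growth along odd [t] determines. *)
Lemma mpoly_top_part (R : realType) n (p V : mpoly n R) D
    (P : ('I_n -> R) -> Prop) (S : set ('I_n -> nat)) (a : 'I_n -> nat -> nat) :
  (forall i, injective (a i)) -> (forall k, S (fun i => a i (k i))) ->
  generic P ->
  (forall b, S b -> P (fun i => (b i)%:R) ->
    meval (fun i => (2 * m).+1%:R * (b i)%:R) p / (2 * m).+1%:R ^+ D
      @[m --> \oo] --> meval (fun i => (b i)%:R) V) ->
  (msize p <= D.+1)%N /\ pihomog (@mdeg n) D p = V.
Proof.
move=> a_inj aS [w w0 wP] pVP.
have {pVP wP} pV b (Sb : S b) (wb : meval (fun i => (b i)%:R) w != 0) :=
  pVP b Sb (wP _ wb).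
have ext (q : mpoly n R) : (forall b, S b -> meval (fun i => (b i)%:R) w != 0 ->
    meval (fun i => (b i)%:R) q = 0) -> q = 0.
  move=> q0; suff : w * q = 0 by move/eqP; rewrite mulf_eq0 (negPf w0) => /eqP.
  apply: (@mpoly_grid_eq0 _ _ (fun i k => (a i k)%:R)) => [i k l|k].
    by move=> /eqP; rewrite eqr_nat => /eqP/a_inj.
  rewrite mevalM; have [->|wb] := eqVneq (meval (fun i => (a i (k i))%:R) w) 0.
    by rewrite mul0r.
  by rewrite (q0 (fun i => a i (k i))) ?mulr0.
pose N := maxn (msize p) D.+1.
have pN : (msize p <= N)%N by rewrite leq_maxl.
have DN : (D < N)%N by rewrite leq_maxr.
have coefs b : S b -> meval (fun i => (b i)%:R) w != 0 ->
    (forall d, (D < d)%N ->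
      meval (fun i => (b i)%:R) (pihomog (@mdeg n) d p) = 0) /\
    meval (fun i => (b i)%:R) (pihomog (@mdeg n) D p) =
      meval (fun i => (b i)%:R) V.
  move=> Sb wb; have := pV b Sb wb.
  under eq_cvg do rewrite (meval_scale _ _ pN).
  move=> /size_lim_horner[szq]; rewrite coef_poly DN => qV; split=> // d Dd.
  have [dN|Nd] := ltnP d N; last first.
    rewrite pihomogE big_seq_cond big_pred0 ?meval0// => m.
    apply/andP => -[/msize_mdeg_lt mp /eqP md].
    by move: mp; rewrite md ltnNge (leq_trans pN).
  have := nth_default 0 (leq_trans szq Dd).
  by rewrite coef_poly dN.
split.
  rewrite msizeE; apply/bigmax_leqP_seq => m pm _; rewrite ltnS leqNgt.
  apply/negP => Dm; move: pm; rewrite mcoeff_msupp => /eqP; apply.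
  rewrite (pihomog_partitionE (mf := @mdeg n) pN) (raddf_sum (mcoeff m)).
  apply: big1 => d _; have [dD|Dd] := leqP d D.
    apply: dhomog_nemf_coeff (pihomogP _ _ _) _.
    by rewrite gtn_eqF// (leq_ltn_trans dD).
  rewrite (ext (pihomog (@mdeg n) d p)) ?raddf0// => b Sb wb.
  exact: (coefs b Sb wb).1.
apply/eqP; rewrite -subr_eq0; apply/eqP/ext => b Sb wb.
by rewrite mevalB (coefs b Sb wb).2 subrr.
Qed.

(** * Counting lattice points by slices *)

Definition in_box d (K : nat) (A : set 'cV[int]_d) : Prop :=
  forall x, A x -> forall i, `|x i 0| <= K%:Z.

Lemma in_box_finite d K (A : set 'cV[int]_d) : in_box K A -> finite_set A.
Proof.
move=> AK; pose f (t : {ffun 'I_d -> 'I_(2 * K).+1}) : 'cV[int]_d :=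
  \col_j ((t j)%:Z - K%:Z).
apply: (@sub_finite_set _ _ (f @` setT)); last exact: finite_image.
move=> x /AK xK; exists [ffun j => inord (absz (x j 0 + K%:Z))] => //.
apply/matrixP => j l; rewrite !mxE ffunE (ord1 l); have := xK j => xj.
by rewrite inordK; lia.
Qed.

Definition slice d (A : set 'cV[int]_(1 + d)) (k : int) : set 'cV[int]_d :=
  [set v | A (col_mx k%:M v)].

Lemma in_box_slice d K (A : set 'cV[int]_(1 + d)) k :
  in_box K A -> in_box K (slice A k).
Proof.
by move=> AK v /AK vK i; have := vK (rshift 1 i); rewrite col_mxEd.
Qed.

Lemma card_slices d K (A : set 'cV[int]_(1 + d)) : in_box K A ->
  #|` fset_set A| =
  (\sum_(k < (2 * K).+1) #|` fset_set (slice A (k%:Z - K%:Z))|)%N.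
Proof.
move=> AK; have Afin := in_box_finite AK.
pose h (x : 'cV[int]_(1 + d)) : 'I_(2 * K).+1 :=
  inord (absz (x (lshift d 0) 0 + K%:Z)).
rewrite card_fset_sum1 (partition_big h xpredT)//=; apply: eq_bigr => k _.
have sfin : finite_set (slice A (k%:Z - K%:Z)).
  exact: in_box_finite (in_box_slice AK).
pose c (v : 'cV[int]_d) : 'cV[int]_(1 + d) := col_mx (k%:Z - K%:Z)%:M v.
have c_inj : injective c by move=> u v /eq_col_mx[].
have -> : (\sum_(i <- fset_set A | h i == k) 1)%N =
    #|` [fset i in fset_set A | h i == k]%fset|.
  by rewrite card_fset_sum1 big_fset.
transitivity #|` (c @` fset_set (slice A (k%:Z - K%:Z)))%fset|; last first.
  by rewrite card_imfset.
rewrite -fset_set_image//.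
congr #|` _|; apply/fsetP => x; rewrite !inE /= !in_fset_set//; last first.
  exact: finite_image.
have c0 v : c v (lshift d 0) 0 = k%:Z - K%:Z.
  by rewrite col_mxEu mxE.
apply/andP/idP => [[]|].
  rewrite !inE => Ax /eqP hx.
  have usx : usubmx x = (k%:Z - K%:Z)%:M.
    apply/matrixP => i j; rewrite !ord1 !mxE eqxx mulr1n -hx /h.
    by move: (x _ _) (AK _ Ax (lshift d 0)) => y yK; rewrite inordK; lia.
  exists (dsubmx x) => /=.
    by rewrite /slice /= -[_%:M]usx vsubmxK.
  by rewrite -[RHS]vsubmxK usx.
rewrite inE => -[v Av <-]; rewrite inE; split=> //.
by apply/eqP/val_inj; rewrite /h c0 subrK /= inordK.
Qed.

Lemma card_in_box d K (A : set 'cV[int]_d) : in_box K A ->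
  (#|` fset_set A| <= (2 * K).+1 ^ d)%N.
Proof.
elim: d A => [|d IHd] A AK.
  rewrite expn0; apply: (@leq_trans #|` [fset (0 : 'cV[int]_0)]%fset|);
    last by rewrite cardfs1.
  apply: fsubset_leq_card.
  by apply/fsubsetP => x _; rewrite inE; apply/eqP/matrixP => -[].
rewrite (card_slices AK) expnS.
apply: (@leq_trans (\sum_(k < (2 * K).+1) (2 * K).+1 ^ d)%N);
  last by rewrite sum_nat_const card_ord.
by apply: leq_sum => k _; apply: IHd; exact: in_box_slice.
Qed.

(** The step functions that turn sums over the integers into integrals: one
    value [h k] on each interval of length [1 / (m + 1)]. *)
Section step.
Variables (R : realType) (h : int -> R) (K m : nat).
Hypothesis h_ge0 : forall k, 0 <= h k.
Hypothesis h_supp : forall k, K%:Z < `|k| -> h k = 0.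

Let step_itv (k : int) : set R :=
  `[k%:~R / m.+1%:R, (k + 1)%:~R / m.+1%:R[%classic.

Let stepE : (fun t : R => (h (Num.floor (m.+1%:R * t)))%:E) =
  (fun t => \sum_(k <- index_enum 'I_(2 * K).+1)
     ((h (k%:Z - K%:Z))%:E * (\1_(step_itv (k%:Z - K%:Z)) t)%:E)%E).
Proof.
apply/funext => t; set j := Num.floor _.
have itvE k : (\1_(step_itv k) t)%:E = ((j == k)%:R : R)%:E.
  congr (_%:E); rewrite indicE; congr (_%:R); congr nat_of_bool.
  by rewrite floor_eq /step_itv mem_setE in_itv /= ler_pdivrMr// ltr_pdivlMr//
    mulrC.
under eq_bigr do rewrite itvE.
have [jK|Kj] := leP `|j| K%:Z; last first.
  rewrite h_supp// big1// => k _; rewrite (_ : j == _ = false) ?mule0//.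
  by apply/eqP => jE; have := ltn_ord k; lia.
have jK' : (absz (j + K%:Z)%R < (2 * K).+1)%N by lia.
rewrite (bigD1 (Ordinal jK'))//=.
rewrite (_ : (absz (j + K%:Z))%:Z - K%:Z = j); last by lia.
rewrite eqxx mule1 big1 ?adde0// => k kj.
rewrite (_ : j == _ = false) ?mule0//.
apply/eqP => jE; move: kj => /eqP; apply; apply/val_inj => /=; lia.
Qed.

Lemma measurable_step :
  measurable_fun setT (fun t : R => (h (Num.floor (m.+1%:R * t)))%:E).
Proof.
rewrite stepE; apply: emeasurable_sum => k.
apply: measurable_funeM; apply/measurable_EFinP.
by apply: measurable_indic; exact: measurable_itv.
Qed.

Lemma integral_step :
  (\int[@lebesgue_measure R]_t (h (Num.floor (m.+1%:R * t)))%:E =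
   ((\sum_(k < (2 * K).+1) h (k%:Z - K%:Z)) / m.+1%:R)%:E)%E.
Proof.
rewrite stepE ge0_integral_sum//; last 2 first.
- move=> k; apply: measurable_funeM; apply/measurable_EFinP.
  by apply: measurable_indic; exact: measurable_itv.
- by move=> k t _; rewrite mule_ge0 ?lee_fin.
rewrite mulr_suml -sumEFin; apply: eq_bigr => k _.
rewrite ge0_integralZl_EFin//; last first.
  by apply/measurable_EFinP; apply: measurable_indic; exact: measurable_itv.
rewrite integral_indic//; last exact: measurable_itv.
rewrite setIT EFinM; congr (_ * _)%E.
rewrite [LHS]lebesgue_measure_itv /= lte_fin ltr_pM2r// ltr_int ltrDl ltr01.
by rewrite -EFinB -mulrBl -rmorphB/= addrAC subrr add0r mul1r.
Qed.

End step.

(** * Lattice points in dilated polytopes and volume *)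

(** The scale is [m + 1] so that sequences indexed by [m] avoid the scale [0]. *)
Definition scaled_points (R : realType) d m (S : set 'cV[R]_d) :
    set 'cV[int]_d :=
  [set y | S (m.+1%:R^-1 *: map_mx intr y)].

Definition density (R : realType) d m (S : set 'cV[R]_d) : R :=
  #|` fset_set (scaled_points m S)|%:R / m.+1%:R ^+ d.

Definition halfspaces (R : realType) k d (C : 'M[R]_(k, d)) (delta : 'cV[R]_k)
    : set 'cV[R]_d :=
  [set x | forall i, (C *m x) i 0 < delta i 0].

Lemma slice_scaled (R : realType) d m (S : set 'cV[R]_(1 + d)) (k : int) :
  slice (scaled_points m S) k =
  scaled_points m [set v | S (col_mx (k%:~R / m.+1%:R)%:M v)].
Proof.
apply/seteqP; split=> v; rewrite /slice /scaled_points /=;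
  by rewrite map_col_mx scale_col_mx map_scalar_mx scale_scalar_mx mulrC.
Qed.

Lemma halfspaces_section (R : realType) k d (C : 'M[R]_(k, 1 + d))
    (delta : 'cV[R]_k) t :
  [set v | halfspaces C delta (col_mx t%:M v)] =
  halfspaces (rsubmx C) (delta - t *: lsubmx C).
Proof.
have mulC v : C *m col_mx t%:M v = t *: lsubmx C + rsubmx C *m v.
  by rewrite -[X in X *m _]hsubmxK mul_row_col mul_mx_scalar.
apply/seteqP; split=> v + i => /(_ i) /=; rewrite mulC.
  by rewrite mxE [X in _ -> _ < X]mxE [(- _ : 'cV[R]_k) _ _]mxE -ltrBrDl.
by rewrite [X in _ -> X < _]mxE [X in _ < X -> _]mxE [(- _ : 'cV[R]_k) _ _]mxE
  -ltrBrDl.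
Qed.

Lemma scaled_in_box (R : realType) d m M (S : set 'cV[R]_d) :
  (forall x, S x -> forall j, `|x j 0| <= M%:R) ->
  in_box (m.+1 * M) (scaled_points m S).
Proof.
move=> SM y /SM yM i; have := yM i; rewrite !mxE.
rewrite normrM ger0_norm ?invr_ge0// mulrC ler_pdivrMr// -natrM.
by rewrite -intr_norm -(ler_int R) mulnC.
Qed.

Lemma density_ge0 (R : realType) d m (S : set 'cV[R]_d) : 0 <= density m S.
Proof. by rewrite divr_ge0// exprn_ge0. Qed.

Lemma density_le (R : realType) d m M (S : set 'cV[R]_d) :
  (forall x, S x -> forall j, `|x j 0| <= M%:R) ->
  density m S <= (2 * M).+1%:R ^+ d.
Proof.
move=> /(scaled_in_box (m := m))/card_in_box SM.
rewrite ler_pdivrMr ?exprn_gt0// -exprMn -natrM -natrX ler_nat.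
apply: (leq_trans SM); have [->|d_gt0] := posnP d; first by rewrite !expn0.
by rewrite leq_exp2r//; nia.
Qed.

Lemma cvg_floor_div (R : realType) (t : R) :
  (Num.floor (m.+1%:R * t))%:~R / m.+1%:R @[m --> \oo] --> t.
Proof.
apply: (@squeeze_cvgr _ _ _ _ (fun m => t - harmonic m) (fun=> t)).
- apply: nearW => m; rewrite /harmonic; set x := m.+1%:R * t.
  rewrite ler_pdivrMr// ler_pdivlMr// mulrBl mulVf// [t * _]mulrC -/x.
  by rewrite (floor_le x) andbT lerBlDr ltW// -[1]/(1%:~R) -intrD floorD1_gt.
- rewrite -[X in _ --> X]subr0.
  by apply: cvgB; [exact: cvg_cst|exact: cvg_harmonic].
- exact: cvg_cst.
Qed.

Lemma abs_le_of_floor (R : realType) m M (t : R) :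
  `|Num.floor (m.+1%:R * t)| <= (m.+1 * M)%N%:Z -> `|t| <= M.+1%:R.
Proof.
have /andP[] := floor_itv (m.+1%:R * t); set j := Num.floor _ => jt tj.
rewrite ler_norml -!(ler_int R) intrN => /andP[].
rewrite -!pmulrn natrM => j1 j2.
have m1 : 1 <= m.+1%:R :> R by rewrite ler1n.
have m0 : 0 < m.+1%:R :> R by [].
rewrite ler_norml -[M.+1%:R]natr1 -(ler_pM2l m0) -[X in _ && X](ler_pM2l m0).
rewrite mulrN mulrDr mulr1; move: tj; rewrite intrD => tj.
apply/andP; split; lra.
Qed.

(** In dimension [0] the polytope is a point or empty, according to the signs of
    the entries of [delta]. *)
Lemma cvg_density0 (R : realType) k (C : 'M[R]_(k, 0)) (delta : 'cV[R]_k)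
    (delta_ : nat -> 'cV[R]_k) :
  (forall i, row i C = 0 ->
    \forall m \near \oo, (0 < delta_ m i 0) = (0 < delta i 0)) ->
  (density m (halfspaces C (delta_ m)))%:E @[m --> \oo] -->
  lebesgue_volume (halfspaces C delta).
Proof.
move=> sgn; apply: cvg_near_cst.
have : \forall m \near \oo, forall i, (0 < delta_ m i 0) = (0 < delta i 0).
  by apply: filter_forall => i; apply: sgn; apply/matrixP => ? [].
apply: filterS => m sgnm; rewrite /= /density expr0 divr1; congr (_%:E).
have memE dl x : halfspaces C dl x = (forall i, 0 < dl i 0).
  rewrite /halfspaces /= (thinmx0 C) mul0mx.
  by apply/propext; split=> + i => /(_ i); rewrite mxE.
have [P0|nP0] := pselect (halfspaces C delta 0).
  have -> : scaled_points m (halfspaces C (delta_ m)) = [set 0].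
    apply/seteqP; split=> x _; first by apply/matrixP => -[].
    by move: P0; rewrite /scaled_points /= !memE => P0 i; rewrite sgnm.
  by rewrite fset_set1 cardfs1 indicE mem_set.
have -> : scaled_points m (halfspaces C (delta_ m)) = set0.
  apply/seteqP; split=> x //; rewrite /scaled_points /= memE => x0.
  by apply: nP0; rewrite memE => i; rewrite -sgnm.
by rewrite fset_set0 cardfs0 indicE memNset.
Qed.

(** The lattice points of the dilates of a polytope with walls [delta_ m] have
    asymptotic density the volume of the polytope with walls [delta]. A zero row
    of [C] is a condition on [delta] alone, which is not continuous at [0];
    hence the second hypothesis. *)
Definition density_cvg (R : realType) k d (C : 'M[R]_(k, d)) : Prop :=
  forall (delta : 'cV[R]_k) (delta_ : nat -> 'cV[R]_k) (M : nat),
  (forall i, delta_ m i 0 @[m --> \oo] --> delta i 0) ->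
  (forall i, row i C = 0 ->
    \forall m \near \oo, (0 < delta_ m i 0) = (0 < delta i 0)) ->
  (forall m x, halfspaces C (delta_ m) x -> forall j, `|x j 0| <= M%:R) ->
  (density m (halfspaces C (delta_ m)))%:E @[m --> \oo] -->
  lebesgue_volume (halfspaces C delta).

(** The slices at height [floor (m t) / m] converge to the slice at [t] of the
    limit polytope, except for the finitely many heights [t] of the walls that
    are parallel to the slices. The slices have bounded density and a bounded
    range of heights, so that the integrals converge as well. *)
Lemma density_cvgS (R : realType) k d (C : 'M[R]_(k, 1 + d)) :
  density_cvg (rsubmx C) -> density_cvg C.
Proof.
move=> IHd delta delta_ M dcvg sgn SM.
pose c := lsubmx C; pose C' := rsubmx C.
pose sect t := halfspaces C' (delta - t *: c).
pose delta' m (j : int) : 'cV[R]_k := delta_ m - (j%:~R / m.+1%:R) *: c.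
pose f m (j : int) : R := density m (halfspaces C' (delta' m j)).
have sectM m j x : halfspaces C' (delta' m j) x -> forall i, `|x i 0| <= M%:R.
  rewrite /C' /delta' -halfspaces_section => /SM xM i.
  by have := xM (rshift 1 i); rewrite col_mxEd.
have fE m j : f m j = #|` fset_set (slice (scaled_points m
    (halfspaces C (delta_ m))) j)|%:R / m.+1%:R ^+ d.
  by rewrite slice_scaled halfspaces_section.
have box m : in_box (m.+1 * M) (scaled_points m
    (halfspaces C (delta_ m))).
  by apply: scaled_in_box; exact: SM.
have f_supp m (j : int) : (m.+1 * M)%N%:Z < `|j| -> f m j = 0.
  move=> Kj; rewrite fE (_ : slice _ _ = set0) ?fset_set0 ?cardfs0 ?mul0r//.
  apply/seteqP; split=> v // /box/(_ (lshift d 0)).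
  by rewrite col_mxEu mxE eqxx mulr1n leNgt Kj.
have f_ge0 m j : 0 <= f m j by exact: density_ge0.
have f_le m j : f m j <= (2 * M).+1%:R ^+ d.
  by apply: density_le; exact: sectM.
(* The heights of the walls that are parallel to the slices: the lattice slices
   may jump there. *)
pose F : set R :=
  [set t | exists2 i, row i C' = 0 & c i 0 != 0 /\ t = delta i 0 / c i 0].
have Ffin : finite_set F.
  apply: (@sub_finite_set _ _ ((fun i => delta i 0 / c i 0) @` [set: 'I_k])).
    by move=> t [i _ [_ ->]]; exists i.
  exact: finite_image.
have fin_meas (B : set R) : B `<=` F -> measurable B.
  move=> BF; apply: countable_measurable => //.
  by apply: finite_set_countable; exact: sub_finite_set BF Ffin.
have mF : measurable F by exact: fin_meas.
have f_cvg t : ~ F t ->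
    (f m (Num.floor (m.+1%:R * t)))%:E @[m --> \oo] -->
      lebesgue_volume (sect t).
  move=> Ft; have dlcvg i : delta' m (Num.floor (m.+1%:R * t)) i 0 @[m --> \oo]
      --> (delta - t *: c) i 0.
    rewrite [X in _ --> X]mxE [X in _ + X]mxE [X in - X]mxE.
    under eq_cvg do rewrite mxE [X in _ + X]mxE [X in - X]mxE.
    by apply: cvgB => //; apply: cvgMr_tmp; exact: cvg_floor_div.
  apply: (IHd _ _ M) => // [i C'i|m]; last exact: sectM.
  have [ci0|ci0] := eqVneq (c i 0) 0.
    have Ci : row i C = 0.
      rewrite -[C](@hsubmxK _ _ 1 d) row_row_mx -/C' C'i.
      rewrite (_ : row i _ = 0) ?row_mx0//; apply/matrixP => i' j'.
      by rewrite !ord1 mxE -/c ci0 mxE.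
    apply: filterS (sgn i Ci) => m; rewrite /delta'.
    by rewrite ![(_ + _ : 'cV[R]_k) _ _]mxE ![(- _ : 'cV[R]_k) _ _]mxE
      ![(_ *: _ : 'cV[R]_k) _ _]mxE ci0 !mulr0 !subr0.
  have : (delta - t *: c) i 0 != 0.
    rewrite [(_ + _ : 'cV[R]_k) _ _]mxE [(- _ : 'cV[R]_k) _ _]mxE.
    rewrite [(_ *: _ : 'cV[R]_k) _ _]mxE.
    rewrite subr_eq0; apply/eqP => dE; apply: Ft; exists i => //; split=> //.
    by rewrite dE mulfK.
  rewrite neq_lt => /orP[lt0|gt0].
    apply: filterS (cvgr_lt _ (dlcvg i) _ lt0) => m lt0'.
    by rewrite !ltNge (ltW lt0) (ltW lt0').
  apply: filterS (cvgr_gt _ (dlcvg i) _ gt0) => m gt0'.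
  by rewrite gt0 gt0'.
pose J : set R := `[- M.+1%:R, M.+1%:R]%classic.
pose g (t : R) : \bar R := (((2 * M).+1%:R ^+ d)%:E * (\1_J t)%:E)%E.
have gi : (@lebesgue_measure R).-integrable setT g.
  by apply: integrableZl => //; exact: integrable_indic_itv.
have mstep m :
    measurable_fun setT (fun t : R => (f m (Num.floor (m.+1%:R * t)))%:E).
  exact: measurable_step (f_supp m).
have mvol : measurable_fun setT (fun t : R => lebesgue_volume (sect t)).
  rewrite -(setvU F); apply/measurable_funU => //.
  - exact: measurableC mF.
  split.
    apply: (@emeasurable_fun_cvg _ _ _ _
      (fun m (t : R) => (f m (Num.floor (m.+1%:R * t)))%:E)) => [m|t /f_cvg//].
    exact: measurable_funS (mstep m).
  by move=> _ Y mY; apply: fin_meas => t [].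
have ae_cvg : {ae @lebesgue_measure R, forall t, setT t ->
    (f m (Num.floor (m.+1%:R * t)))%:E @[m --> \oo] -->
      lebesgue_volume (sect t)}.
  exists F; split=> //.
    exact/countable_lebesgue_measure0/finite_set_countable.
  by move=> t /= h; apply: contrapT => /f_cvg tcvg; apply: h.
have bound : {ae @lebesgue_measure R, forall t m, setT t ->
    (`| (f m (Num.floor (m.+1%:R * t)))%:E | <= g t)%E}.
  apply: aeW => t m _; rewrite /g /= lee_fin ger0_norm//.
  set j := Num.floor _.
  have [jM|/f_supp->] := leP `|j| (m.+1 * M)%N%:Z; last first.
    by rewrite mulr_ge0// exprn_ge0.
  rewrite indicE mem_set ?mulr1// /J /= in_itv /=.
  by have := abs_le_of_floor jM; rewrite ler_norml.
have [_ _] := @dominated_convergence _ (measurableTypeR R) R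
  lebesgue_measure setT measurableT _ _ _ mstep mvol ae_cvg gi bound.
rewrite /= -/(lebesgue_volume _).
set L1 := (X in _ --> X -> _); set L2 := (X in _ -> _ --> X).
have -> : L2 = L1.
  by apply: eq_integral => t _; rewrite halfspaces_section.
apply: cvg_trans; apply: near_eq_cvg; apply: nearW => m /=.
rewrite (integral_step m (f_ge0 m) (f_supp m)); congr (_%:E).
rewrite /density (card_slices (@box m)) natr_sum exprSr invfM mulrA !mulr_suml.
by apply: eq_bigr => j _; rewrite fE.
Qed.

Lemma cvg_density (R : realType) k d (C : 'M[R]_(k, d)) : density_cvg C.
Proof.
elim: d C => [|d IHd] C; last exact: density_cvgS.
by move=> delta delta_ M _ sgn _; exact: cvg_density0.
Qed.

(** * The lattice of integer points of a kernel *)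

(** The columns of [U] span the lattice of integer points of [ker A], and [W]
    reads off coordinates integrally. Asking for [U W z = z] over every numeric
    domain serves both the integer points and the real points of the kernel. *)
Definition kernel_splitting n e d (A : 'M[int]_(n, e)) (U : 'M[int]_(e, d))
    (W : 'M[int]_(d, e)) : Prop :=
  [/\ W *m U = 1%:M, A *m U = 0 &
    forall (R : numDomainType) (z : 'cV[R]_e),
      real_mx R A *m z = 0 -> z = real_mx R U *m (real_mx R W *m z)].

(** In a Smith normal form [A = L S Q], independence of the rows of [A] makes
    the first [n] diagonal entries of [S] nonzero. The kernel of [S] is then the
    span of the last [d] coordinate vectors, and the inverse of [Q] carries it
    to [ker A]: [U] consists of the last columns of that inverse, and [W] of the
    last rows of [Q]. *)
Lemma kernel_splitting_exists n e (A : 'M[int]_(n, e)) :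
  (forall c : 'rV[int]_n, c *m A = 0 -> c = 0) ->
  exists d (U : 'M[int]_(e, d)) (W : 'M[int]_(d, e)),
    e = (n + d)%N /\ kernel_splitting A U W.
Proof.
move=> Afree.
have [L Lu [Q Qu [s _ AE]]] := int_Smith_normal_form A.
pose S : 'M[int]_(n, e) := \matrix_(i, j) (s`_i *+ (i == j :> nat)).
have row_ne0 (i : 'I_n) : row i S != 0.
  apply/eqP => Si.
  have := Afree (delta_mx 0 i *m invmx L).
  rewrite {1}AE !mulmxA mulmxKV// -/S -[_ *m S]rowE.
  rewrite Si mul0mx => /(_ erefl)/(congr1 (mulmxr L)) /=.
  rewrite mulmxKV// mul0mx => /matrixP/(_ 0 i)/eqP.
  by rewrite !mxE !eqxx oner_eq0.
have ne : (n <= e)%N.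
  rewrite leqNgt; apply/negP => en; have := row_ne0 (Ordinal en).
  case/negP; apply/eqP/matrixP => i j; rewrite !mxE /=.
  by rewrite gtn_eqF ?mulr0n.
have s_ne0 (i : 'I_n) : s`_i != 0.
  apply: contraNneq (row_ne0 i) => si.
  by apply/eqP/matrixP => k j; rewrite !mxE si mul0rn.
pose d := (e - n)%N; have eE : e = (n + d)%N by rewrite subnKC.
clearbody d; subst e.
have Qd : Q *m invmx Q = 1%:M by exact: mulmxV.
exists d, (rsubmx (invmx Q)), (dsubmx Q); split=> //; split.
- rewrite mul_dsub_mx mulmx_rsub Qd scalar_mx_block block_mxEh.
  by rewrite row_mxKr col_mxKd.
- have SE : S = row_mx (\matrix_(i, j) (s`_i *+ (i == j :> nat))) 0.
    apply/matrixP => i j; rewrite !mxE; case: splitP => k jk; rewrite !mxE jk//.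
    by rewrite ltn_eqF// ltn_addr.
  rewrite AE -/S -mulmxA mulmx_rsub Qd scalar_mx_block block_mxEh row_mxKr.
  by rewrite SE -mulmxA mul_row_col mulmx0 mul0mx addr0 mulmx0.
move=> R z; rewrite AE -/S !map_mxM /= -!mulmxA.
move=> /(congr1 (mulmx (real_mx R (invmx L)))).
rewrite mulmxA -map_mxM mulVmx// map_mx1 mul1mx mulmx0 => Sy0.
rewrite map_dsubmx map_rsubmx mul_dsub_mx.
have {1}-> : z = real_mx R (invmx Q) *m (real_mx R Q *m z).
  by rewrite mulmxA -map_mxM mulVmx// map_mx1 mul1mx.
have yu : usubmx (real_mx R Q *m z) = 0.
  apply/matrixP => i j; move/matrixP/(_ i j): Sy0; rewrite mxE mxE.
  rewrite (bigD1 (lshift d i))//= big1 ?addr0 => [|k ki].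
    rewrite !mxE eqxx mulr1n => /eqP.
    by rewrite mulf_eq0 intr_eq0 (negPf (s_ne0 i)) => /eqP.
  rewrite !mxE (_ : (i == k :> nat) = false) ?mul0r//.
  by apply/eqP => ik; move/eqP: ki; apply; apply/val_inj.
rewrite -[real_mx R Q *m z in LHS]vsubmxK yu.
by rewrite -[real_mx R (invmx Q) in LHS]hsubmxK mul_row_col mulmx0 add0r.
Qed.

Lemma real_mx_int m n (A : 'M[int]_(m, n)) : real_mx int A = A.
Proof. by apply/matrixP => i j; rewrite mxE intz. Qed.

Lemma kernel_basis_inj n e d (A : 'M[int]_(n, e)) (B : 'M[int]_(e, d))
    (t : 'cV[int]_d) :
  kernel_basis A B -> B *m t = 0 -> t = 0.
Proof.
move=> /(_ 0)[+ _] => /(_ (mulmx0 _ _))[s [_ us]] Bt0.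
by rewrite -(us t) ?Bt0// (us 0) ?mulmx0.
Qed.

Lemma kernel_basis_mul0 n e d (A : 'M[int]_(n, e)) (B : 'M[int]_(e, d)) :
  kernel_basis A B -> A *m B = 0.
Proof.
move=> kB; apply/matrixP => i j.
have -> : (A *m B) i j = (A *m (B *m delta_mx j (0 : 'I_1))) i 0.
  by rewrite mulmxA -colE [RHS]mxE.
suff -> : A *m (B *m delta_mx j (0 : 'I_1)) = 0 by rewrite !mxE.
apply/(kB _).2.
exists (delta_mx j (0 : 'I_1)); split=> // t Bt; apply/eqP; rewrite -subr_eq0.
by apply/eqP/(kernel_basis_inj kB); rewrite mulmxBr Bt subrr.
Qed.

(** Any other basis [B] of the kernel lattice differs from [U] by an invertible
    integer matrix, and so has the same size and its own coordinate map. *)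
Lemma kernel_basis_splitting n e d0 d (A : 'M[int]_(n, e))
    (U : 'M[int]_(e, d0)) (W : 'M[int]_(d0, e)) (B : 'M[int]_(e, d)) :
  kernel_splitting A U W -> kernel_basis A B ->
  d = d0 /\ exists X : 'M[int]_(d, e), kernel_splitting A B X.
Proof.
move=> [WU AU zE] kB.
have BE : B = U *m (W *m B).
  apply/matrixP => i j.
  have : B *m delta_mx j (0 : 'I_1) = U *m (W *m B) *m delta_mx j 0.
    have := zE int (B *m delta_mx j (0 : 'I_1)); rewrite !real_mx_int !mulmxA.
    by apply; rewrite (kernel_basis_mul0 kB) mul0mx.
  by rewrite -!colE => /matrixP/(_ i 0); rewrite [LHS]mxE [RHS]mxE.
have /choice[u uE] : forall j : 'I_d0, exists t, col j U = B *m t.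
  move=> j; have [+ _] := kB (col j U); case.
    by rewrite colE mulmxA AU mul0mx.
  by move=> t [-> _]; exists t.
pose T : 'M[int]_(d, d0) := \matrix_(i, j) u j i 0.
have UE : U = B *m T.
  apply/matrixP => i j; have /matrixP/(_ i 0) := uE j; rewrite !mxE => ->.
  by apply: eq_bigr => k _; rewrite mxE.
have TWB : T *m (W *m B) = 1%:M.
  apply/eqP; rewrite -subr_eq0; apply/eqP/matrixP => i j.
  have : B *m ((T *m (W *m B) - 1%:M) *m delta_mx j (0 : 'I_1)) = 0.
    by rewrite mulmxA mulmxBr (mulmxA B T) -UE -BE mulmx1 subrr mul0mx.
  by move=> /(kernel_basis_inj kB)/matrixP/(_ i 0); rewrite -colE !mxE.
have WBT : (W *m B) *m T = 1%:M by rewrite -mulmxA -UE.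
split; first by apply/eqP; rewrite eqn_leq !(mulmx1_min TWB, mulmx1_min WBT).
exists (T *m W); split; [by rewrite -mulmxA|exact: kernel_basis_mul0|].
by move=> R z /zE {1}->; rewrite {1}UE !map_mxM /= -!mulmxA.
Qed.

Lemma kernel_splitting_basis n e d (A : 'M[int]_(n, e))
    (U : 'M[int]_(e, d)) (W : 'M[int]_(d, e)) :
  kernel_splitting A U W -> kernel_basis A U.
Proof.
move=> [WU AU zE] y; split=> [Ay0|[t [-> _]]]; last by rewrite mulmxA AU mul0mx.
have := zE int y; rewrite !real_mx_int => /(_ Ay0) yE.
exists (W *m y); split=> // t ->; by rewrite mulmxA WU mul1mx.
Qed.

Lemma real_mx_inj (R : numDomainType) m n :
  injective (fun A : 'M[int]_(m, n) => real_mx R A).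
Proof.
move=> A B /matrixP AB; apply/matrixP => i j.
by have := AB i j; rewrite !mxE => /intr_inj.
Qed.

(** * Lattice points of the polytopes [A x = b] *)

Definition positive_columns n e (A : 'M[int]_(n, e)) : Prop :=
  (forall i j, 0 <= A i j) /\ (forall j, exists i, 0 < A i j).

Lemma polytope_le (R : realType) n e (A : 'M[int]_(n, e)) (b : 'I_n -> R) x j :
  positive_columns A -> polytope A b x -> x j 0 <= \sum_i b i.
Proof.
move=> [A0 /(_ j)[i Aij]] [x0 Ax].
have bE k : b k = \sum_j (A k j)%:~R * x j 0.
  move/matrixP/(_ k 0): Ax; rewrite !mxE => <-.
  by apply: eq_bigr => l _; rewrite mxE.
have t0 k l : 0 <= (A k l)%:~R * x l 0 by rewrite mulr_ge0 ?ler0z// ltW.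
apply: (@le_trans _ _ (b i)); last first.
  by rewrite (bigD1 i)//= lerDl sumr_ge0// => k _; rewrite bE sumr_ge0.
rewrite bE (bigD1 j)//=; apply: (@le_trans _ _ ((A i j)%:~R * x j 0)).
  have A1 : (1%:~R : R) <= (A i j)%:~R by rewrite ler_int.
  exact: ler_peMl (ltW (x0 j)) A1.
by rewrite lerDl sumr_ge0.
Qed.

Lemma halfspacesN (R : realType) k d (C : 'M[R]_(k, d)) (delta : 'cV[R]_k) t :
  halfspaces (- C) delta t = (forall i, 0 < (delta + C *m t) i 0).
Proof.
rewrite /halfspaces /=; apply/propext; split=> + i => /(_ i);
  rewrite mulNmx [(- (C *m t)) i 0]mxE [(delta + _) i 0]mxE; lra.
Qed.

(** The columns of [B] parametrize the lattice points of [A x = m b] from the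
    integer point [m y0], while the volume is computed from the real point [x0].
    The two origins differ by [B w]; rounding [m w] to an integer vector
    replaces one by the other at the cost of moving the walls of the polytope by
    [O(1 / m)], which [cvg_density] allows. *)
Lemma cvg_lattice_top (R : realType) n e d (A : 'M[int]_(n, e))
    (b : 'I_n -> nat) (y0 : 'cV[int]_e) (x0 : 'cV[R]_e)
    (B : 'M[int]_(e, d)) (X : 'M[int]_(d, e)) :
  positive_columns A -> A *m y0 = \col_i (b i)%:Z ->
  real_mx R A *m x0 = \col_i (b i)%:R -> kernel_splitting A B X ->
  #|` fset_set (lattice_points A (fun i => m.+1%:R * (b i)%:R : R))|%:R
      / m.+1%:R ^+ d @[m --> \oo] -->
  fine (lebesgue_volume
    [set t : 'cV[R]_d | polytope A (fun i => (b i)%:R) (x0 + real_mx R B *m t)]).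
Proof.
move=> Apos Ay0 Ax0 [XB AB zE].
pose BR := real_mx R B; pose XR := real_mx R X; pose y0R := real_mx R y0.
have ABR : real_mx R A *m BR = 0 by rewrite -map_mxM AB map_mx0.
have Ay0R : real_mx R A *m y0R = \col_i (b i)%:R.
  by rewrite -map_mxM Ay0; apply/matrixP => i j; rewrite !mxE.
pose w := XR *m (x0 - y0R).
have Bw : BR *m w = x0 - y0R by rewrite -zE// mulmxBr Ax0 Ay0R subrr.
(* [err m] is the rounding error in [w], and [delta m] the moved walls. *)
pose fl m : 'cV[int]_d := \col_j Num.floor (m.+1%:R * w j 0).
pose err m := m.+1%:R^-1 *: real_mx R (fl m) - w.
pose delta m := x0 + BR *m err m.
pose shift m (s : 'cV[int]_d) := m.+1%:Z *: y0 + B *m (s + fl m).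
have shiftE m s : real_mx R (shift m s) =
    m.+1%:R *: (delta m + BR *m (m.+1%:R^-1 *: real_mx R s)).
  rewrite /shift map_mxD map_mxZ map_mxM map_mxD /= -/y0R -/BR.
  have m0 : m.+1%:R != 0 :> R by rewrite pnatr_eq0.
  rewrite /delta /err mulmxBr Bw -!scalemxAr mulmxDr -pmulrn.
  move: (BR *m _) (BR *m _) => P Q; apply/matrixP => i j; rewrite !mxE.
  by field.
have polyE t : polytope A (fun i => (b i)%:R) (x0 + BR *m t) <->
    halfspaces (- BR) x0 t.
  rewrite halfspacesN; split=> [[]//|t0]; split=> //.
  by rewrite mulmxDr mulmxA ABR mul0mx addr0.
have deltaE m t :
    halfspaces (- BR) (delta m) t = halfspaces (- BR) x0 (err m + t).
  by rewrite !halfspacesN /delta -addrA -mulmxDr.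
have errE m j : err m j 0 = (Num.floor (m.+1%:R * w j 0))%:~R / m.+1%:R - w j 0.
  by rewrite !mxE mulrC.
have err_le m j : `|err m j 0| <= 1.
  have m0 : 0 < m.+1%:R :> R by [].
  have m1 : 1 <= m.+1%:R :> R by rewrite ler1n.
  have /andP[] := floor_itv (m.+1%:R * w j 0); rewrite intrD => f1 f2.
  rewrite errE ler_distl ler_pdivlMr// ler_pdivrMr//.
  apply/andP; split; nra.
have [M MP] : exists M : nat, forall m t, halfspaces (- BR) (delta m) t ->
    forall j, `|t j 0| <= M%:R.
  pose c j := \sum_k `|XR j k| * (\sum_i (b i)%:R + `|x0 k 0|).
  have c_ge0 j : 0 <= c j.
    by apply: sumr_ge0 => k _; rewrite mulr_ge0// addr_ge0// sumr_ge0.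
  exists (Num.bound (\sum_j c j + 1)) => m t; rewrite deltaE => /polyE pt j.
  have p_le k := polytope_le k Apos pt; have [p_gt0 _] := pt.
  have tE : t = XR *m (x0 + BR *m (err m + t) - x0) - err m.
    rewrite [x0 + _]addrC addrK mulmxA -map_mxM XB map_mx1 mul1mx.
    by rewrite [err m + t]addrC addrK.
  have c_le : c j + 1 <= (Num.bound (\sum_j c j + 1))%:R.
    apply: ltW; apply: le_lt_trans (archi_boundP _); last first.
      by rewrite addr_ge0// sumr_ge0.
    by rewrite lerD2r (bigD1 j)//= lerDl sumr_ge0.
  apply: le_trans c_le.
  rewrite {1}tE [fun_of_matrix (_ - _) _ _]mxE [(- err m) j 0]mxE.
  apply: le_trans (ler_normB _ _) _; apply: lerD (err_le m j).
  rewrite mxE; apply: le_trans (ler_norm_sum _ _ _) _; apply: ler_sum => k _.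
  rewrite normrM ler_wpM2l// [fun_of_matrix (_ - _) _ _]mxE [(- x0) k 0]mxE.
  apply: le_trans (ler_normB _ _) _; rewrite lerD2r ger0_norm ?p_le//.
  exact/ltW/p_gt0.
have lattE m : lattice_points A (fun i => m.+1%:R * (b i)%:R : R) =
    shift m @` scaled_points m (halfspaces (- BR) (delta m)).
  have m0 : 0 < m.+1%:R :> R by [].
  have pos s : scaled_points m (halfspaces (- BR) (delta m)) s <->
      forall j, 0 < real_mx R (shift m s) j 0.
    rewrite /scaled_points /= halfspacesN shiftE.
    by split=> + j => /(_ j);
      rewrite [fun_of_matrix (_ *: (_ + _)) _ _]mxE pmulr_rgt0.
  have Ashift s : A *m shift m s = m.+1%:Z *: \col_i (b i)%:Z.
    by rewrite mulmxDr -scalemxAr Ay0 mulmxA AB mul0mx addr0.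
  apply/seteqP; split=> [x [x_gt0 Ax]|_ [s /pos s_gt0 <-]].
    pose v := x - m.+1%:Z *: y0.
    have Av : A *m v = 0.
      apply: (@real_mx_inj R); rewrite mulmxBr -scalemxAr Ay0 map_mxB map_mxM Ax.
      by apply/matrixP => i j; rewrite !mxE /= intrM subrr.
    have vE : v = B *m (X *m v) by have := zE int v; rewrite !real_mx_int; apply.
    have xE : shift m (X *m v - fl m) = x.
      by rewrite /shift subrK -vE addrC subrK.
    by exists (X *m v - fl m) => //; apply/pos; rewrite xE.
  split=> //; rewrite -map_mxM Ashift.
  by apply/matrixP => i j; rewrite !mxE /= intrM.
have shift_inj m : injective (shift m).
  move=> s t /addrI/(congr1 (mulmx X)); rewrite !mulmxA XB !mul1mx.
  exact: addIr.
have countE m :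
    #|` fset_set (lattice_points A (fun i => m.+1%:R * (b i)%:R : R))|%:R
      / m.+1%:R ^+ d = density m (halfspaces (- BR) (delta m)).
  rewrite lattE fset_set_image; last first.
    apply: (@in_box_finite _ (m.+1 * M)%N).
    by apply: scaled_in_box => t; exact: MP.
  by rewrite card_imfset.
under eq_cvg do rewrite countE.
have volE : [set t : 'cV[R]_d | polytope A (fun i => (b i)%:R) (x0 + BR *m t)] =
    halfspaces (- BR) x0.
  by apply/seteqP; split=> t /polyE.
rewrite volE.
have err_cvg j : err m j 0 @[m --> \oo] --> 0.
  have -> : (fun m => err m j 0) =
      (fun m => (Num.floor (m.+1%:R * w j 0))%:~R / m.+1%:R - w j 0).
    by apply/funext => m; exact: errE.
  by rewrite -(subrr (w j 0)); apply: cvgB (cvg_cst _); exact: cvg_floor_div.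
have delta_cvg i : delta m i 0 @[m --> \oo] --> x0 i 0.
  have -> : x0 i 0 = x0 i 0 + \sum_j BR i j * 0.
    by rewrite big1 ?addr0// => j _; rewrite mulr0.
  under eq_cvg do
    rewrite /delta [fun_of_matrix (_ + _) _ _]mxE [fun_of_matrix (_ *m _) _ _]mxE.
  apply: cvgD; first exact: cvg_cst.
  apply: cvg_big => [|j _]; first exact: add_continuous.
  exact: cvgMl_tmp.
have cvg : (density m (halfspaces (- BR) (delta m)))%:E @[m --> \oo] -->
    lebesgue_volume (halfspaces (- BR) x0).
  apply: (cvg_density delta_cvg _ MP) => i Bi; apply: nearW => m; congr (_ < _).
  rewrite /delta mxE (_ : (BR *m _) i 0 = 0) ?addr0//.
  have Bi0 : row i BR = 0 by apply: oppr_inj; rewrite -linearN /= Bi oppr0.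
  have := row_mul i BR (err m); rewrite Bi0 mul0mx => /matrixP/(_ 0 0).
  by rewrite !mxE.
have ge0 : (0 <= lebesgue_volume (halfspaces (- BR) x0))%E.
  by apply: cvge_ge cvg; apply: nearW => m; rewrite lee_fin density_ge0.
have le : (lebesgue_volume (halfspaces (- BR) x0) <= ((2 * M).+1%:R ^+ d)%:E)%E.
  apply: cvge_le cvg; apply: nearW => m; rewrite lee_fin.
  by apply: density_le => t; exact: MP.
have fin : lebesgue_volume (halfspaces (- BR) x0) \is a fin_num.
  by rewrite ge0_fin_numE// (le_lt_trans le)// ltry.
by rewrite -(fineK fin) in cvg; exact: fine_cvg cvg.
Qed.

Lemma lattice_points_mul (R : realType) n e (A : 'M[int]_(n, e))
    (b : 'I_n -> nat) m x :
  lattice_points A (fun i => m.+1%:R * (b i)%:R : R) x ->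
  real_mx R A *m real_mx R x = m.+1%:R *: \col_i (b i)%:R.
Proof. by move=> [_ ->]; apply/matrixP => i j; rewrite !mxE. Qed.

(** The coordinate map [W] is injective on the solutions of [A x = m b] and
    sends the positive integer ones into a cube of side [O(m)] in dimension
    [d]. *)
Lemma cvg_lattice_low (R : realType) n e d D (A : 'M[int]_(n, e))
    (b : 'I_n -> nat) (U : 'M[int]_(e, d)) (W : 'M[int]_(d, e)) :
  positive_columns A -> (d < D)%N -> kernel_splitting A U W ->
  #|` fset_set (lattice_points A (fun i => m.+1%:R * (b i)%:R : R))|%:R
      / m.+1%:R ^+ D @[m --> \oo] --> (0 : R).
Proof.
move=> Apos dD [_ _ zE].
pose L m := lattice_points A (fun i => m.+1%:R * (b i)%:R : R).
pose beta := (\sum_i b i)%N.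
have L_box m : in_box (m.+1 * beta) (L m).
  move=> x Lx j; have := polytope_le j Apos Lx; have [/(_ j)] := Lx.
  rewrite !mxE ltr0z => xj0; rewrite -mulr_sumr -natr_sum -natrM => xj.
  by rewrite (ger0_norm (ltW xj0)) -(ler_int R).
have W_inj m : {in fset_set (L m) &, injective (mulmx W)}.
  have Lfin := in_box_finite (L_box m).
  move=> x y; rewrite !in_fset_set// !inE.
  move=> /lattice_points_mul Ax /lattice_points_mul Ay Wxy.
  apply/eqP; rewrite -subr_eq0; apply/eqP/(@real_mx_inj R).
  rewrite map_mxB [LHS](zE R) -?map_mxB -?map_mxM ?mulmxBr ?Wxy ?subrr ?map_mx0
    ?mulmx0//.
  by rewrite map_mxB !map_mxM Ax Ay subrr.
pose K := (\sum_i \sum_j absz (W i j) * beta)%N.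
have W_box m : in_box (m.+1 * K) (mulmx W @` L m).
  move=> _ [x Lx <-] i; rewrite mxE; apply: le_trans (ler_norm_sum _ _ _) _.
  apply: (@le_trans _ _ (\sum_j (m.+1 * (absz (W i j) * beta))%N%:Z)).
    apply: ler_sum => j _; rewrite normrM mulnCA PoszM abszE.
    by rewrite ler_wpM2l//; exact: L_box.
  rewrite -(big_morph Posz PoszD (erefl 0%:Z)) lez_nat -big_distrr /=.
  by rewrite leq_mul2l /K (bigD1 i)//= leq_addr.
have L_card m : (#|` fset_set (L m)| <= (m.+1 * (2 * K).+1) ^ d)%N.
  have Lfin := in_box_finite (L_box m).
  have -> : #|` fset_set (L m)| = #|` fset_set (mulmx W @` L m)|.
    by rewrite fset_set_image// card_in_imfset//; exact: W_inj.
  apply: leq_trans (card_in_box (W_box m)) _.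
  have [->|d_gt0] := posnP d; first by rewrite !expn0.
  by rewrite leq_exp2r//; nia.
apply: (@squeeze_cvgr _ _ _ _ (fun=> 0)
  (fun m => (2 * K).+1%:R ^+ d * harmonic m)).
- apply: nearW => m; rewrite divr_ge0 ?exprn_ge0//=.
  have m0 : 0 < m.+1%:R :> R by [].
  rewrite ler_pdivrMr ?exprn_gt0// /harmonic -mulrA.
  apply: (@le_trans _ _ ((m.+1 * (2 * K).+1) ^ d)%N%:R).
    by rewrite ler_nat; exact: L_card.
  rewrite natrX natrM exprMn mulrC ler_wpM2l ?exprn_ge0//.
  by rewrite ler_pdivlMl// -exprS; apply: ler_weXn2l; rewrite ?ler1n.
- exact: cvg_cst.
- rewrite -(mulr0 ((2 * K).+1%:R ^+ d)).
  by apply: cvgMl_tmp; exact: cvg_harmonic.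
Qed.

(** The second alternative on the left kernel says that [b] is off a hyperplane
    that contains all [b] for which [A x = b] is solvable. *)
Lemma cvg_lattice (R : realType) n e D (A : 'M[int]_(n, e)) (b : 'I_n -> nat) :
  positive_columns A -> (e <= n + D)%N ->
  (forall c : 'rV[int]_n, c *m A = 0 -> c = 0) \/
  (exists2 c : 'rV[int]_n, c *m A = 0 &
     \sum_i (c 0 i)%:~R * (b i)%:R != 0 :> R) ->
  (e = n + D -> exists y : 'cV[int]_e, A *m y = \col_i (b i)%:Z)%N ->
  #|` fset_set (lattice_points A (fun i => m.+1%:R * (b i)%:R : R))|%:R
      / m.+1%:R ^+ D @[m --> \oo] -->
  polytope_volume D A (fun i => (b i)%:R : R).
Proof.
move=> Apos enD [Afree|[c cA cb]] ysol; last first.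
  have nosol (x : 'cV[R]_e) t :
      real_mx R A *m x = t *: \col_i (b i)%:R -> t = 0.
    move=> /(congr1 (mulmx (real_mx R c))).
    rewrite mulmxA -map_mxM cA map_mx0 mul0mx.
    have cbE : (real_mx R c *m \col_i (b i)%:R) 0 0 =
        \sum_i (c 0 i)%:~R * (b i)%:R.
      by rewrite mxE; apply: eq_bigr => i _; rewrite !mxE.
    rewrite -scalemxAr => /matrixP/(_ 0 0)/esym/eqP; rewrite [X in _ == X]mxE.
    rewrite [fun_of_matrix (_ *: _) _ _]mxE cbE mulf_eq0 (negPf cb) orbF.
    by move/eqP.
  have -> : polytope_volume D A (fun i => (b i)%:R : R) = 0.
    rewrite /polytope_volume; case: pselect => // h; exfalso.
    have [[B x] [_ /= Ax]] := h; have := nosol x 1; rewrite scale1r.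
    by move=> /(_ Ax)/eqP; rewrite oner_eq0.
  apply: cvg_near_cst; apply: nearW => m.
  have -> : lattice_points A (fun i => m.+1%:R * (b i)%:R : R) = set0.
    apply/seteqP; split=> // x /lattice_points_mul/nosol/eqP.
    by rewrite pnatr_eq0.
  by rewrite fset_set0 cardfs0 mul0r.
have [d [U [W [ed UW]]]] := kernel_splitting_exists Afree.
have dD : (d <= D)%N by rewrite -(leq_add2l n) -ed.
have [d_ltD|Dd] := ltnP d D.
  have -> : polytope_volume D A (fun i => (b i)%:R : R) = 0.
    rewrite /polytope_volume; case: pselect => // h; exfalso.
    have [[B x] [/= kB _]] := h.
    have [De _] := kernel_basis_splitting UW kB.
    by rewrite De ltnn in d_ltD.
  exact: cvg_lattice_low UW.
have dE : d = D by apply/eqP; rewrite eqn_leq Dd dD.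
subst D.
have [y0 Ay0] := ysol ed.
rewrite /polytope_volume; case: pselect => h; last first.
  exfalso; apply: h; exists (U, real_mx R y0); split=> /=.
    exact: kernel_splitting_basis UW.
  by rewrite -map_mxM Ay0; apply/matrixP => i j; rewrite !mxE.
case: (cid h) => -[B x0] [/= kB Ax0].
have [_ [X BX]] := kernel_basis_splitting UW kB.
exact: cvg_lattice_top Ay0 Ax0 BX.
Qed.

(** * The incidence matrix of a fatgraph *)

Section fatgraph.
Variables (g n : nat) (X : finType) (G : fatdata X n).
Hypothesis fatG : is_fatgraph g G.

Let tau1P x : tau1 G x != x /\ tau1 G (tau1 G x) = x.
Proof. by have /and5P[/forallP/(_ x)/andP[? /eqP]] := fatG. Qed.

Let labelP x y : (label G x == label G y) = (y \in porbit (tau2 G) x).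
Proof. by have /and5P[_ _ _ /forallP/(_ x)/forallP/(_ y)/eqP] := fatG. Qed.

Let euler : (#|vertices G| + #|boundaries G| + 2 * g = #|edges G| + 2)%N.
Proof. by have /and5P[_ _ _ _ /andP[_ /eqP]] := fatG. Qed.

Lemma porbit_tau1 x : porbit (tau1 G) x = [set x; tau1 G x]%SET.
Proof.
apply/setP => y; apply/porbitP/idP => [[i ->]|].
  elim: i => [|i]; first by rewrite expg0 perm1 !inE eqxx.
  rewrite expgSr permM !inE => /orP[] /eqP ->; rewrite ?eqxx ?orbT //.
  by rewrite (tau1P x).2 eqxx.
by rewrite !inE => /orP[] /eqP ->; [exists 0|exists 1];
  rewrite ?expg0 ?perm1 ?expg1.
Qed.

Lemma card_edges : #|X| = (2 * #|edges G|)%N.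
Proof.
rewrite -cardsT (card_partition (porbits_partition (tau1 G))) mulnC.
rewrite -sum_nat_const; apply: eq_bigr => _ /imsetP[x _ ->].
by rewrite porbit_tau1 cards2 eq_sym (tau1P x).1.
Qed.

Lemma card_boundaries : (#|boundaries G| <= n)%N.
Proof.
pose f i :=
  odflt finset.set0 (omap (porbit (tau2 G)) [pick x | label G x == i]).
apply: (@leq_trans #|f @: [set: 'I_n]|%SET); last first.
  by rewrite (leq_trans (leq_imset_card _ _))// cardsT card_ord.
apply/subset_leq_card/fintype.subsetP => _ /imsetP[x _ ->]; apply/imsetP.
exists (label G x) => //; rewrite /f.
case: pickP => [y|/(_ x)]; last by rewrite eqxx.
by rewrite eq_sym labelP -eq_porbit_mem eq_sym => /eqP.
Qed.

Lemma edges_le : (2 < 2 * g + n)%N -> (#|edges G| <= n + moduli_dim g n)%N.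
Proof.
by move=> st; have := fatgraph_size fatG; rewrite card_edges /moduli_dim; lia.
Qed.

(** If all valencies were at least [4], the Euler characteristic would leave
    room for fewer edges. *)
Lemma trivalent_vertex : (2 < 2 * g + n)%N ->
  #|edges G| = (n + moduli_dim g n)%N -> exists x, #|porbit (tau0 G) x| = 3%N.
Proof.
move=> st eE; apply: contrapT => no3.
have : (4 * #|vertices G| <= #|X|)%N.
  rewrite -cardsT (card_partition (porbits_partition (tau0 G))) mulnC.
  rewrite -sum_nat_const; apply: leq_sum => v vG.
  have /and5P[_ /forall_inP/(_ v vG) v2 _ _ _] := fatG.
  rewrite ltn_neqAle v2 andbT; apply/eqP => v3; apply: no3.
  by case/imsetP: vG v3 => x _ -> v3; exists x.
have := card_boundaries; have := euler; move: eE.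
rewrite card_edges /moduli_dim; lia.
Qed.

(** The boundary component that comes in along [tau1 G x] leaves along the next
    edge at the source of [x], which is [tau0 G x]. *)
Lemma label_tau x : label G (tau1 G x) = label G (tau0 G x).
Proof.
apply/eqP; rewrite labelP -[x in tau0 G x](tau1P x).2 -[tau0 G _]permM.
exact: (mem_porbit (tau2 G) 1).
Qed.

Let unit_vec i : 'cV[int]_n := delta_mx i 0.

Lemma incidence_col x : exists j,
  incidence G *m delta_mx j (0 : 'I_1) =
    unit_vec (label G x) + unit_vec (label G (tau1 G x)).
Proof.
have ex : porbit (tau1 G) x \in edges G by apply: imset_f.
exists (enum_rank_in ex (porbit (tau1 G) x)); rewrite -colE.
apply/matrixP => i k; rewrite !mxE ord1 eqxx !andbT enum_rankK_in//.
rewrite porbit_tau1 -natrD natz; congr Posz.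
have [x1 _] := tau1P x.
rewrite (cardsD1 x) (cardsD1 (tau1 G x)) !inE !eqxx x1 /= orbT /=.
rewrite (_ : _ :\ _ = finset.set0) ?cards0 ?addn0; last first.
  by apply/setP => y; rewrite !inE; case: eqP; case: eqP.
by congr (_ + _)%N; congr nat_of_bool; rewrite eq_sym.
Qed.

Lemma incidence_positive : positive_columns (incidence G).
Proof.
split=> [i j|j]; first by rewrite mxE.
have /imsetP[x _ jx] := enum_valP j.
exists (label G x); rewrite mxE ltz_nat card_gt0; apply/set0Pn; exists x.
by rewrite inE jx porbit_id eqxx.
Qed.

Let reach (v : 'cV[int]_n) := exists y, incidence G *m y = v.

Let reach_eq u v : u = v -> reach u -> reach v.
Proof. by move->. Qed.
Let reach0 : reach 0.
Proof. by exists 0; rewrite mulmx0. Qed.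
Let reachD u v : reach u -> reach v -> reach (u + v).
Proof. by move=> [x <-] [y <-]; exists (x + y); rewrite mulmxDr. Qed.
Let reachZ c u : reach u -> reach (c *: u).
Proof. by move=> [x <-]; exists (c *: x); rewrite -scalemxAr. Qed.
Let reachB u v : reach u -> reach v -> reach (u - v).
Proof. by move=> ? /(reachZ (-1)); rewrite scaleN1r; exact: reachD. Qed.

(** Write [e i] for the unit vectors. The columns are the sums [e i + e j] with
    [i] and [j] the two sides of an edge. At a trivalent vertex, with corners
    [i], [j], [k], one gets [2 e i] as the alternating sum of [e i + e j],
    [e j + e k] and [e k + e i]. As the graph is connected, [e i + e l] is then
    in the span for every [l], and these vectors together with [2 e i] span all
    vectors of even sum. *)
Lemma incidence_even (b : 'I_n -> nat) : (2 < 2 * g + n)%N ->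
  #|edges G| = (n + moduli_dim g n)%N -> ~~ odd (\sum_i b i)%N ->
  exists y, incidence G *m y = \col_i (b i)%:Z.
Proof.
move=> st eE evb; rewrite -/(reach _).
have edge x : reach (unit_vec (label G x) + unit_vec (label G (tau1 G x))).
  by have [j jE] := incidence_col x; exists (delta_mx j 0).
have [u u3] := trivalent_vertex st eE.
pose a := unit_vec (label G u).
have aa : reach (a + a).
  have t3 : tau0 G (tau0 G (tau0 G u)) = u.
    by have := iter_porbit (tau0 G) u; rewrite u3.
  have := reachB (reachD (edge u) (edge (tau0 G (tau0 G u)))) (edge (tau0 G u)).
  rewrite !label_tau t3 -/a; apply: reach_eq.
  by apply/matrixP => i j; rewrite !mxE; lia.
have all_a x : reach (a + unit_vec (label G x)).
  have /and5P[_ _ /forallP/(_ u)/forallP/(_ x)/connectP[p up ->] _ _] := fatG.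
  suff step v : path (fun u v => (v == tau0 G u) || (v == tau1 G u)) v p ->
      reach (a + unit_vec (label G v)) ->
      reach (a + unit_vec (label G (last v p))).
    exact: step up aa.
  elim: p v {up} => //= y p IHp v /andP[vy yp] av.
  apply: IHp yp _.
  have -> : label G y = label G (tau1 G v).
    by case/orP: vy => /eqP -> //; rewrite label_tau.
  apply: reach_eq (reachD (reachB (edge v) av) aa).
  by apply/matrixP => i j; rewrite !mxE; lia.
have -> : \col_i (b i)%:Z = \sum_i (b i)%:Z *: (a + unit_vec i)
    - (\sum_i b i)./2%:Z *: (a + a).
  rewrite (eq_bigr (fun i => (b i)%:Z *: a + (b i)%:Z *: unit_vec i)); last first.
    by move=> i _; rewrite scalerDr.
  rewrite big_split /= -scaler_suml -(big_morph Posz PoszD (erefl 0%:Z)).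
  rewrite -[X in X%:Z *: a](odd_double_half (\sum_i b i)) (negPf evb) add0n.
  rewrite -[a + a]mulr2n -scaler_nat scalerA -muln2 PoszM addrC addrK.
  apply/matrixP => i j; rewrite !mxE summxE (bigD1 i)//= big1 ?addr0.
    by rewrite !mxE ord1 !eqxx mulr1.
  by move=> k ki; rewrite !mxE eq_sym (negPf ki) mulr0.
apply: reachB (reachZ _ aa).
have label_surj i : exists x, label G x = i.
  have /and5P[_ _ _ _ /andP[/forallP/(_ i)/existsP[x /eqP xi] _]] := fatG.
  by exists x.
apply: (big_ind reach) => // i _; apply: reachZ.
by have [x <-] := label_surj i; exact: all_a.
Qed.
End fatgraph.

(** * Comparison of the top degree parts *)

Lemma Fat_fatgraph g n k (G : fatdata 'I_k n) :
  G \in Fat g n k -> is_fatgraph g G.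
Proof.
rewrite /Fat; set D := [set G | is_fatgraph g G]%SET.
set P := equivalence_partition _ _.
case/imsetP => x; rewrite inE => xfat ->; case: pickP => [y|_] //=.
rewrite /finset.pblock.
case: (pickP [pred B in P | x \in B]) => [B /=|_ /=]; last by rewrite inE.
by case/andP => /imsetP[z _ ->] _; rewrite !inE => /andP[].
Qed.

Theorem theorem3 (R : realType) (g n : nat) (n_gt0 : (1 <= n)%N)
    (stable : (2 < 2 * g + n)%N)
    (V : mpoly n R) (volV : is_volume_polynomial g V)
    (eps : 'I_n -> bool) (even_eps : ~~ odd (\sum_(i < n) eps i)%N)
    (p : mpoly n R) (countp : is_count_polynomial g eps p) :
  (msize p <= (moduli_dim g n).+1)%N /\
  pihomog (@mdeg n) (moduli_dim g n) p = V.
Proof.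
have [_ [H H0 VE]] := volV; set D := moduli_dim g n.
pose ker_ok k (G : fatdata 'I_k n) (b : 'I_n -> R) :=
  (forall c : 'rV[int]_n, c *m incidence G = 0 -> c = 0) \/
  (exists2 c : 'rV[int]_n, c *m incidence G = 0 &
     \sum_i (c 0 i)%:~R * b i != 0).
have ker_gen k (G : fatdata 'I_k n) : generic (ker_ok k G).
  have [free|nfree] :=
      pselect (forall c : 'rV[int]_n, c *m incidence G = 0 -> c = 0).
    by apply: genericT => b; left.
  have [c cA c0] : exists2 c : 'rV[int]_n, c *m incidence G = 0 & c != 0.
    apply: contrapT => nc; apply: nfree => c cA; apply: contrapT => /eqP c0.
    by apply: nc; exists c.
  have cR0 : map_mx intr c != 0 :> 'rV[R]_n.
    by apply: contra_neq c0 => cR0; apply: (@real_mx_inj R); rewrite cR0 map_mx0.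
  have [w w0 wP] := generic_affine 0 cR0.
  exists w => // b /wP cb; right; exists c => //.
  by congr (_ != _): cb; apply: eq_bigr => i _; rewrite mxE.
(* General position: off the walls of [V], and off a hyperplane for each
   fatgraph whose incidence matrix has dependent rows. *)
have Pgen : generic (fun b : 'I_n -> R =>
    {in H, forall h : 'rV[R]_n * R, \sum_i h.1 0 i * b i != h.2} /\
    forall (k : 'I_(12 * g + 6 * n - 12).+1) (G : fatdata 'I_k n), ker_ok k G b).
  apply: generic_and.
    have [v v0 vP] := generic_forall (fun i : 'I_(size H) =>
      generic_affine (H`_i).2 (H0 _ (mem_nth 0 (ltn_ord i)))).
    exists v => // b /vP bP h hH.
    have hi : (index h H < size H)%N by rewrite index_mem.
    by have := bP (Ordinal hi); rewrite /= nth_index.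
  by apply: generic_forall => k; apply: generic_forall => G; exact: ker_gen.
pose S : set ('I_n -> nat) :=
  [set b | (forall i, 0 < b i)%N /\ forall i, odd (b i) = eps i].
(* The values [2 k + 2 + eps i] are positive and of the parity of [eps i]. *)
apply: (mpoly_top_part (S := S) (a := fun i k => (k.*2.+2 + eps i)%N)) Pgen _.
- by move=> i k l; lia.
- move=> k; split=> i; first by rewrite addn_gt0.
  by rewrite oddD /= odd_double; case: (eps i).
move=> b [b_gt0 b_odd] [bH bker].
rewrite VE; last 2 first.
- by move=> i; rewrite ltr0n.
- exact: bH.
have pE m : meval (fun i => (2 * m).+1%:R * (b i)%:R) p =
    lattice_count R g (fun i => (2 * m).+1 * b i)%N.
  rewrite -countp => [|i|i].
  - by apply: meval_eq => i; rewrite natrM.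
  - by rewrite muln_gt0 b_gt0.
  - by rewrite oddM /= mul2n odd_double b_odd.
have b_even : ~~ odd (\sum_i b i)%N.
  suff -> : odd (\sum_i b i) = odd (\sum_(i < n) eps i)%N by [].
  rewrite !(big_morph odd oddD (erefl (odd 0))).
  by apply: eq_bigr => i _; rewrite b_odd; case: (eps i).
pose u m : R := fat_sum g (fun k (G : fatdata 'I_k n) =>
  #|` fset_set (lattice_points (incidence G) (fun i => m.+1%:R * (b i)%:R : R))|%:R
   / m.+1%:R ^+ D).
have -> : (fun m : nat =>
      meval (fun i => (2 * m).+1%:R * (b i)%:R) p / (2 * m).+1%:R ^+ D) =
    (fun m => u (2 * m)%N).
  apply/funext => m; rewrite pE /lattice_count /u /fat_sum mulr_suml.
  apply: eq_bigr => k _; rewrite mulr_suml; apply: eq_bigr => G _.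
  rewrite -mulrA; congr (_ * (#|` fset_set (lattice_points _ _) |%:R * _)).
  by apply/funext => i; rewrite natrM.
apply: cvg_even; rewrite /u /fat_sum.
apply: cvg_big => [|k _]; first exact: add_continuous.
apply: cvg_big => [|G GF]; first exact: add_continuous.
apply: cvgMl_tmp; have fatG := Fat_fatgraph GF.
apply: cvg_lattice.
- exact: incidence_positive.
- exact: edges_le fatG stable.
- exact: bker.
- by move=> eE; have := @incidence_even _ _ _ _ fatG b stable eE b_even.
Qed.
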